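(* Suppose that: (A) each $f_i$ is convex, $L_i$-smooth for some $L_i>0$, and bounded from below, $h_i\equiv 0$ for all $i\in\mathcal V$, and the problem $\min_{x\in\mathbb{R}^d}\sum_{i\in\mathcal V}f_i(x)$ has a non-empty and bounded optimal solution set; (B) (partial asynchrony) there exist non-negative integers $B$ and $D$ such that for every $i\in\mathcal V$ and every $k\in\mathbb{N}_0$ at least one element of $\{k,\dots,k+B\}$ belongs to $\mathcal K_i$, and $k-D\le s_{ij}^k\le k$ for all $i\in\mathcal V$, $j\in\mathcal N_i$ and $k\in\mathcal K_i$; (C) $\displaystyle\alpha\in\Bigl(0,\frac{2}{\max_{i\in\mathcal V}L_i}\Bigr)$. Then, for any initial point $\mathbf{x}^0\in\mathbb{R}^{nd}$, the sequence $\{\mathbf{x}^k\}$ generated by the asynchronous DGD-ATC converges to some fixed point $\mathbf{x}^\star$ of the synchronous DGD-ATC. If, in addition, each $f_i$ is $\mu_i$-strongly convex for some $\mu_i>0$, then for all $k\in\mathbb{N}_0$ $$\|\mathbf{x}^k-\mathbf{x}^\star\|_\infty^b\le\hat\rho^{\lfloor k/(B+D+1)\rfloor}\|\mathbf{x}^0-\mathbf{x}^\star\|_\infty^b,\qquad\text{where}\quad\hat\rho=\sqrt{1-\alpha\min_{i\in\mathcal V}\bigl(\mu_i(2-\alpha L_i)\bigr)}\in[0,1).$$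
   Context: $\mathcal G=(\mathcal V,\mathcal E)$ is an undirected connected graph with vertex set $\mathcal V=\{1,\dots,n\}$; $\mathcal E$ contains no self-loops; $\mathcal N_i=\{j:\{i,j\}\in\mathcal E\}$ and $\bar{\mathcal N}_i=\mathcal N_i\cup\{i\}$. For each $i\in\mathcal V$, $f_i:\mathbb{R}^d\to\mathbb{R}$ (the general problem has an additional term $h_i$ in each local cost, here zero). A differentiable function $f$ is $L$-smooth if $\|\nabla f(y)-\nabla f(x)\|\le L\|y-x\|$ for all $x,y$, and $\mu$-strongly convex if $\langle\nabla f(y)-\nabla f(x),y-x\rangle\ge\mu\|y-x\|^2$ for all $x,y$. For $\mathbf{x}=(x_1^T,\dots,x_n^T)^T\in\mathbb{R}^{nd}$ with $x_i\in\mathbb{R}^d$, put $f(\mathbf{x})=\sum_{i}f_i(x_i)$ and $\|\mathbf{x}\|_\infty^b=\max_{i\in\mathcal V}\|x_i\|$ (Euclidean norm on each block). $W=(w_{ij})\in\mathbb{R}^{n\times n}$ is a positive definite averaging matrix associated with $\mathcal G$: it is symmetric positive definite and doubly stochastic (non-negative, rows and columns sum to 1), and $w_{ij}>0$ if $\{i,j\}\in\mathcal E$ or $i=j$, $w_{ij}=0$ otherwise. $\mathbf{W}=W\otimes I_d$. Synchronous DGD-ATC with step-size $\alpha>0$: $\mathbf{x}^{k+1}=\mathbf{W}(\mathbf{x}^k-\alpha\nabla f(\mathbf{x}^k))$; a fixed point is $\mathbf{x}^\star$ with $\mathbf{x}^\star=\mathbf{W}(\mathbf{x}^\star-\alpha\nabla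 f(\mathbf{x}^\star))$. Asynchronous DGD-ATC with step-size $\alpha$: for each $i\in\mathcal V$ and $k\in\mathbb{N}_0=\{0,1,2,\dots\}$, $$x_i^{k+1}=\begin{cases}\sum_{j\in\bar{\mathcal N}_i}w_{ij}\bigl(x_j^{s_{ij}^k}-\alpha\nabla f_j(x_j^{s_{ij}^k})\bigr),&k\in\mathcal K_i,\\ x_i^k,&\text{otherwise},\end{cases}$$ where $\mathcal K_i\subseteq\mathbb{N}_0$ is the set of iterations at which node $i$ updates, the integer $s_{ij}^k\in[0,k]$, $j\in\mathcal N_i$, is the iteration index of the most recent $y_j=x_j-\alpha\nabla f_j(x_j)$ that node $i$ has received from $j$, and $s_{ii}^k=k$. *)

(* Defs.v *)
From HB Require Import structures.
From mathcomp Require Import all_boot all_order all_algebra.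
From mathcomp Require Import all_classical all_reals all_analysis.
Set Implicit Arguments.
Unset Strict Implicit.
Unset Printing Implicit Defensive.
Import Order.TTheory GRing.Theory Num.Theory.
Import numFieldNormedType.Exports.
Local Open Scope classical_set_scope.
Local Open Scope ring_scope.

Section Euclidean.
Context {R : realType} {d : nat}.
Implicit Types (f : 'rV[R]_d -> R) (u v : 'rV[R]_d).

(* The library norm `|u| on matrices is the max norm, so the Euclidean inner
   product and norm are introduced separately. *)
Definition dotp u v : R := \sum_(l < d) u 0 l * v 0 l.
Definition enorm u : R := Num.sqrt (dotp u u).

Definition gradient f u : 'rV[R]_d := \row_(l < d) 'D_(delta_mx 0 l) f u.

Definition smooth (L : R) f : Prop :=
  (forall u, differentiable f u) /\
  (forall u v, enorm (gradient f v - gradient f u) <= L * enorm (v - u)).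

Definition strongly_convex (mu : R) f : Prop :=
  (forall u, differentiable f u) /\
  (forall u v,
     mu * enorm (v - u) ^+ 2 <= dotp (gradient f v - gradient f u) (v - u)).

Definition minimizers f : set 'rV[R]_d := [set u | forall v, f u <= f v].

End Euclidean.

Section Network.
Context {R : realType} {n d : nat}.
(* A stacked vector (x_1, ..., x_n) of R^(nd) is stored as the n x d matrix x
   whose i-th row is the block x_i. Under this identification the action of
   W (x) I_d is x |-> W *m x. *)
Implicit Types (x : 'M[R]_(n, d)) (W : 'M[R]_n) (e : rel 'I_n).

Definition bnorm x : R := \big[Num.max/0]_(i < n) enorm (row i x).

Definition connected_graph e : Prop :=
  [/\ symmetric e, irreflexive e & forall i j, connect e i j].

Definition positive_definite W : Prop :=
  W^T = W /\ forall v : 'rV[R]_n, v != 0 -> 0 < (v *m W *m v^T) 0 0.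

Definition doubly_stochastic W : Prop :=
  [/\ forall i j, 0 <= W i j, forall i, \sum_j W i j = 1
    & forall j, \sum_i W i j = 1].

Definition pd_averaging_matrix e W : Prop :=
  [/\ positive_definite W, doubly_stochastic W,
      forall i j, e i j || (i == j) -> 0 < W i j
    & forall i j, ~~ (e i j || (i == j)) -> W i j = 0].

Variables (e : rel 'I_n) (W : 'M[R]_n) (f : 'I_n -> 'rV[R]_d -> R) (alpha : R).

Definition stacked_gradient x : 'M[R]_(n, d) :=
  \matrix_(i < n) gradient (f i) (row i x).

Definition sync_fixed_point x : Prop :=
  x = W *m (x - alpha *: stacked_gradient x).

(* [K i] is the set of update times of node i, and [s i j k] the index of the
   iterate of node j that node i uses at its update time k. *)
Definition async_dgd_atc (K : 'I_n -> set nat) (s : 'I_n -> 'I_n -> nat -> nat)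
    (x : nat -> 'M[R]_(n, d)) : Prop :=
  [/\ forall i k, k \in K i -> s i i k = k,
      forall i j k, e i j -> k \in K i -> (s i j k <= k)%N
    & forall i k, row i (x k.+1) =
        if k \in K i then
          \sum_(j < n | e i j || (j == i))
            W i j *: (row j (x (s i j k))
                      - alpha *: gradient (f j) (row j (x (s i j k))))
        else row i (x k)].

End Network.

Definition partially_asynchronous (n : nat) (e : rel 'I_n)
    (K : 'I_n -> set nat) (s : 'I_n -> 'I_n -> nat -> nat) (B D : nat) : Prop :=
  (forall i k, exists2 t, (k <= t <= k + B)%N & t \in K i) /\
  (forall i j k, e i j -> k \in K i -> (k - D <= s i j k <= k)%N).

(* Main.v *)
(* For [alpha L_j < 2] the gradient step [g_j u = u - alpha grad f_j u] is
   nonexpansive (Baillon-Haddad), and it preserves the distance of two points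
   only when the gradients at these points agree. Fixed points exist because
   they are the critical points of the coercive convex function
   [alpha sum_i f_i(x_i) + <x, (W^-1 - I) x> / 2].
   For a fixed point [y], let [v] be the limit superior of the block-max
   distance from the iterates to [y]. Along an ultrafilter, the shifted
   iterates converge to a trajectory [Z] of the same kind which stays within
   [v] of [y] and reaches distance exactly [v] at a late time. Strict
   convexity of the Euclidean norm propagates this extremality backwards in
   time and to all neighbours with the same deviation vector, hence, by
   connectedness, to every node: on a whole delay window, [Z] is constant and
   equal to [y] translated by one vector at each node, with the gradients of
   [y], so it is a fixed point. The iterates come arbitrarily close to it on a
   whole window, and nonexpansiveness then forces convergence. *)
Require Import Defs.
From HB Require Import structures.
From mathcomp Require Import all_boot all_order all_algebra.
From mathcomp Require Import all_classical all_reals all_analysis.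
From mathcomp Require Import ring lra zify.
Set Implicit Arguments.
Unset Strict Implicit.
Unset Printing Implicit Defensive.
Import Order.TTheory GRing.Theory Num.Theory.
Import numFieldNormedType.Exports.
Local Open Scope classical_set_scope.
Local Open Scope ring_scope.

(** * Euclidean geometry *)

Section EuclideanSpace.
Context {R : realType} {d : nat}.
Implicit Types (u v w : 'rV[R]_d) (a : R).

Lemma dotpC u v : dotp u v = dotp v u.
Proof. by apply: eq_bigr => l _; rewrite mulrC. Qed.

Lemma dotpDl u v w : dotp (u + v) w = dotp u w + dotp v w.
Proof. by rewrite -big_split; apply: eq_bigr => l _; rewrite mxE mulrDl. Qed.

Lemma dotpZl a u v : dotp (a *: u) v = a * dotp u v.
Proof. by rewrite mulr_sumr; apply: eq_bigr => l _; rewrite mxE mulrA. Qed.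

Lemma dotpDr u v w : dotp u (v + w) = dotp u v + dotp u w.
Proof. by rewrite dotpC dotpDl !(dotpC _ u). Qed.

Lemma dotpZr a u v : dotp u (a *: v) = a * dotp u v.
Proof. by rewrite dotpC dotpZl dotpC. Qed.

Lemma dotpNl u v : dotp (- u) v = - dotp u v.
Proof. by rewrite -scaleN1r dotpZl mulN1r. Qed.

Lemma dotpNr u v : dotp u (- v) = - dotp u v.
Proof. by rewrite dotpC dotpNl dotpC. Qed.

Lemma dotp0l u : dotp 0 u = 0.
Proof. by rewrite -(scale0r 0) dotpZl mul0r. Qed.

Lemma dotp_suml I (r : seq I) (P : pred I) (F : I -> 'rV[R]_d) v :
  dotp (\sum_(i <- r | P i) F i) v = \sum_(i <- r | P i) dotp (F i) v.
Proof.
by elim/big_rec2: _ => [|i y1 y2 _ <-]; rewrite ?dotp0l// dotpDl.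
Qed.

Definition dotpE := (dotpDl, dotpDr, dotpZl, dotpZr, dotpNl, dotpNr).

Lemma dotp_ge0 u : 0 <= dotp u u.
Proof. by apply: sumr_ge0 => l _; exact: sqr_ge0. Qed.

Lemma dotp_eq0 u : dotp u u = 0 -> u = 0.
Proof.
move=> /eqP; rewrite psumr_eq0 => [/allP u0|l _]; last exact: sqr_ge0.
apply/rowP => l; rewrite mxE; apply/eqP.
by have := u0 l (mem_index_enum _); rewrite mulf_eq0 orbb.
Qed.

Lemma enorm_ge0 u : 0 <= enorm u. Proof. exact: sqrtr_ge0. Qed.

Lemma sqr_enorm u : enorm u ^+ 2 = dotp u u.
Proof. by rewrite sqr_sqrtr// dotp_ge0. Qed.

Lemma enorm_eq0 u : enorm u = 0 -> u = 0.
Proof. by move=> u0; apply: dotp_eq0; rewrite -sqr_enorm u0 expr0n. Qed.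

Lemma enorm0 : enorm (0 : 'rV[R]_d) = 0.
Proof. by rewrite /enorm dotp0l sqrtr0. Qed.

Lemma le_enorm u a : 0 <= a -> (enorm u <= a) = (dotp u u <= a ^+ 2).
Proof. by move=> a0; rewrite -sqr_enorm ler_sqr// nnegrE ?enorm_ge0. Qed.

Lemma enormZ a u : enorm (a *: u) = `|a| * enorm u.
Proof.
by rewrite /enorm !dotpE mulrA -expr2 sqrtrM ?sqr_ge0// sqrtr_sqr.
Qed.

Lemma enormN u : enorm (- u) = enorm u.
Proof. by rewrite -scaleN1r enormZ normrN1 mul1r. Qed.

Lemma enormC u v : enorm (u - v) = enorm (v - u).
Proof. by rewrite -enormN opprB. Qed.

Lemma dotp_le_enorm u v : dotp u v <= enorm u * enorm v.
Proof.
have [u0|u0] := eqVneq (enorm u) 0.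
  by rewrite (enorm_eq0 u0) dotp0l enorm0 mul0r.
have [v0|v0] := eqVneq (enorm v) 0.
  by rewrite (enorm_eq0 v0) dotpC dotp0l enorm0 mulr0.
have := dotp_ge0 (enorm v *: u - enorm u *: v).
rewrite !dotpE -!sqr_enorm (dotpC v u).
have : 0 < enorm u * enorm v by rewrite mulr_gt0// lt_def ?u0 ?v0 enorm_ge0.
move: (enorm u) (enorm v) (dotp u v) => a b c ab H.
have {}H : 0 <= (a * b) * (a * b - c) by move: H; nra.
by rewrite pmulr_rge0// subr_ge0 in H.
Qed.

Lemma enormD u v : enorm (u + v) <= enorm u + enorm v.
Proof.
rewrite le_enorm ?addr_ge0 ?enorm_ge0// !dotpE -!sqr_enorm (dotpC v u).
have := dotp_le_enorm u v; nra.
Qed.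

Lemma enorm_tri u v w : enorm (u - w) <= enorm (u - v) + enorm (v - w).
Proof. by rewrite (le_trans _ (enormD _ _))// addrA subrK. Qed.

Lemma enorm_coord u l : `|u 0 l| <= enorm u.
Proof.
rewrite -(ler_sqr (normr_ge0 _) (enorm_ge0 _)) sqr_enorm real_normK ?num_real//.
rewrite /dotp (bigD1 l)//= expr2 lerDl sumr_ge0// => k _; exact: sqr_ge0.
Qed.

Lemma enorm_sum I (r : seq I) (P : pred I) (F : I -> 'rV[R]_d) :
  enorm (\sum_(i <- r | P i) F i) <= \sum_(i <- r | P i) enorm (F i).
Proof.
elim/big_rec2: _ => [|i y1 y2 _ h]; first by rewrite enorm0.
by rewrite (le_trans (enormD _ _))// lerD2l.
Qed.

End EuclideanSpace.

(* The Euclidean norm is strictly convex: expanding [v^2 = <u, u>] as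
   [sum_j p_j <u, y_j>] gives [sum_j p_j |y_j - u|^2 <= 0]. *)
Lemma wavg_extremal {R : realType} {d : nat} (I : finType) (P : pred I)
    (p : I -> R) (y : I -> 'rV[R]_d) (v : R) :
  (forall j, P j -> 0 < p j) -> \sum_(j | P j) p j = 1 ->
  (forall j, P j -> enorm (y j) <= v) ->
  enorm (\sum_(j | P j) p j *: y j) = v ->
  forall j, P j -> y j = \sum_(j | P j) p j *: y j.
Proof.
move=> p0 p1 yv; set u := \sum_(j | P j) _ => uv.
have v0 : 0 <= v by rewrite -uv enorm_ge0.
have H : \sum_(j | P j) p j * dotp (y j - u) (y j - u) <= 0.
  have -> : \sum_(j | P j) p j * dotp (y j - u) (y j - u) =
     \sum_(j | P j) (p j * dotp (y j) (y j)) - dotp u u.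
    transitivity (\sum_(j | P j) (p j * dotp (y j) (y j) +
       (dotp (p j *: y j) (- 2 *: u) + p j * dotp u u))).
      apply: eq_bigr => j _; rewrite !dotpE (dotpC u); ring.
    rewrite big_split big_split /= -dotp_suml -mulr_suml p1 -/u !dotpE; ring.
  rewrite subr_le0 -sqr_enorm uv -[leRHS]mul1r -p1 mulr_suml.
  apply: ler_sum => j Pj; rewrite ler_wpM2l// ?(ltW (p0 _ _))//.
  by rewrite -le_enorm// yv.
have H0 j : P j -> 0 <= p j * dotp (y j - u) (y j - u).
  by move=> Pj; rewrite mulr_ge0// ?dotp_ge0// ltW// p0.
have /eqP : \sum_(j | P j) p j * dotp (y j - u) (y j - u) = 0.
  by apply/eqP; rewrite eq_le H sumr_ge0.
rewrite psumr_eq0// => /allP Hj j Pj.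
have := Hj j (mem_index_enum _); rewrite Pj /= mulf_eq0 gt_eqF ?p0//= => /eqP.
by move/dotp_eq0/eqP; rewrite subr_eq0 => /eqP.
Qed.

(** * Smooth convex functions *)

Lemma addrBl {V : zmodType} (u w : V) : u + w - u = w.
Proof. by rewrite addrC addKr. Qed.

Section SmoothConvex.
Context {R : realType} {d : nat}.
Implicit Types (f : 'rV[R]_d.+1 -> R) (u v w h : 'rV[R]_d.+1) (L mu a b t : R).

Lemma derive_gradient f u h : differentiable f u ->
  'D_h f u = dotp (gradient f u) h.
Proof.
move=> fu; rewrite deriveE// [in LHS](row_sum_delta h) linear_sum /=.
by apply: eq_bigr => l _; rewrite linearZ/= mxE deriveE// mulrC.
Qed.

Lemma is_derive_line f u h t : (forall v, differentiable f v) ->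
  is_derive t (1 : R) (fun t : R => f (u + t *: h))
    (dotp (gradient f (u + t *: h)) h).
Proof.
move=> df.
have E : (fun s : R => s^-1 *: ((((fun t : R => f (u + t *: h)) \o shift t)
      (s *: 1)) - f (u + t *: h))) =
    (fun s : R => s^-1 *: ((f \o shift (u + t *: h)) (s *: h)
      - f (u + t *: h))).
  apply: funext => s /=; congr (_ *: (f _ - _)).
  rewrite [s *: 1]mulr1 scalerDl; rewrite addrCA; congr (_ + _).
split.
  by rewrite /derivable E; exact: diff_derivable.
by rewrite /derive E -derive_gradient.
Qed.

Lemma mean_value f u v : (forall w, differentiable f w) ->
  exists2 t : R, 0 <= t <= 1 &
    f v - f u = dotp (gradient f (u + t *: (v - u))) (v - u).
Proof.
move=> df; have dl t := is_derive_line u (v - u) t df.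
have cont : {within `[0, 1], continuous (fun t : R => f (u + t *: (v - u)))}.
  by apply: derivable_within_continuous => t _; exact: ex_derive.
have [t t01] := MVT_segment ler01 (fun t _ => dl t) cont.
rewrite scale1r scale0r addr0 subrKC subr0 mulr1 => ->; exists t => //.
Qed.

(** Descent lemma. Subtracting the whole quadratic model from [f] along the segment leaves a
    function of [t] with nonpositive derivative on [[0, 1]], so one mean value argument gives the
    sharp constant [L / 2]. *)
Lemma smooth_upper L f u v : smooth L f ->
  f v <= f u + dotp (gradient f u) (v - u) + L / 2 * enorm (v - u) ^+ 2.
Proof.
move=> [df lf]; set h := v - u.
pose g (t : R) := f (u + t *: h) - (t * dotp (gradient f u) h
  + t ^+ 2 * (L / 2 * enorm h ^+ 2)).
have dg (t : R) : is_derive t (1 : R) g (dotp (gradient f (u + t *: h)) h -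
    (dotp (gradient f u) h + 2 * t * (L / 2 * enorm h ^+ 2))).
  have ? := is_derive_line u h t df.
  apply: is_derive_eq; rewrite /GRing.scale/=; ring.
have cont : {within `[0, 1], continuous g}.
  by apply: derivable_within_continuous => t _; exact: ex_derive.
have [t /[!in_itv]/=/andP[t0 _]] := MVT_segment ler01 (fun t _ => dg t) cont.
rewrite /g scale1r scale0r addr0 subrKC subr0 mulr1 => E.
suff: dotp (gradient f (u + t *: h)) h - dotp (gradient f u) h
    <= t * L * enorm h ^+ 2 by move: E; rewrite -/h; nra.
rewrite -dotpNl -dotpDl (le_trans (dotp_le_enorm _ _))// expr2 mulrA.
rewrite ler_wpM2r ?enorm_ge0// (le_trans (lf _ _))// addrBl enormZ.
by rewrite ger0_norm// mulrCA mulrA.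
Qed.

Lemma smooth_lower L f u v : 0 <= L -> smooth L f ->
  f u + dotp (gradient f u) (v - u) - L * enorm (v - u) ^+ 2 <= f v.
Proof.
move=> L0 [df lf]; have [t /andP[t0 t1] E] := mean_value u v df.
suff: - (dotp (gradient f (u + t *: (v - u))) (v - u)
   - dotp (gradient f u) (v - u)) <= L * enorm (v - u) ^+ 2 by move: E; nra.
rewrite -dotpNl -dotpDl -dotpNl (le_trans (dotp_le_enorm _ _))// expr2 mulrA.
rewrite ler_wpM2r ?enorm_ge0// enormN (le_trans (lf _ _))//.
rewrite addrBl enormZ ger0_norm//.
by rewrite ler_wpM2l// ler_piMl// enorm_ge0.
Qed.

Lemma convex_functionE f u v (t : R) : convex_function setT f -> 0 <= t <= 1 ->
  f (t *: u + (1 - t) *: v) <= t * f u + (1 - t) * f v.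
Proof.
move=> cf /andP[t0 t1].
have h : ((0 <= t) && (t <= 1))%R by rewrite t0.
have /(_ u v) := cf (@Itv01 _ t t0 t1).
by rewrite !inE; move=> /(_ I I).
Qed.

(** The passage to the limit [t -> 0] that ends first-order arguments after division by [t]. *)
Lemma le0_of_le_scaled (a b : R) :
  (forall t : R, 0 < t <= 1 -> a <= t * b) -> a <= 0.
Proof.
move=> H; rewrite leNgt; apply/negP => a0.
have b0 : 0 < b by have := H 1; rewrite mul1r ltr01 lexx => /(_ isT); lra.
pose t := Num.min 1 (a / (2 * b)).
have ab : 0 < a / (2 * b) by rewrite divr_gt0// mulr_gt0.
have t0 : 0 < t by rewrite /t lt_min ltr01.
have t1 : t <= 1 by rewrite /t; case: (leP 1) => // /ltW.
have := H t; rewrite t0 t1 => /(_ isT).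
have : t * b <= a / (2 * b) * b.
  by rewrite ler_wpM2r ?(ltW b0)// /t; case: (leP 1).
have -> : a / (2 * b) * b = a / 2 by field; rewrite gt_eqF.
lra.
Qed.

(** At [u + t *: (v - u)], convexity bounds [f] from above and [smooth_lower] from below, with an
    error of order [t ^ 2]; divide by [t] and let [t] tend to 0. *)
Lemma convex_above_tangent L f u v : 0 <= L -> smooth L f ->
  convex_function setT f -> f u + dotp (gradient f u) (v - u) <= f v.
Proof.
move=> L0 sf cf; rewrite -subr_le0.
apply: (@le0_of_le_scaled _ (L * enorm (v - u) ^+ 2)) => t /andP[t0 t1].
have := @convex_functionE f v u t cf; rewrite (ltW t0) t1 => /(_ isT).
have -> : t *: v + (1 - t) *: u = u + t *: (v - u).
  by rewrite scalerBl scale1r scalerBr addrCA.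
have := smooth_lower u (u + t *: (v - u)) L0 sf.
rewrite addrBl enormZ (gtr0_norm t0) exprMn dotpE => A B.
rewrite -(ler_pM2l t0); nra.
Qed.

(** The point [v - L^-1 *: p] is a gradient step from [v] for [f] minus its linear part at [u].
    There the tangent at [u] bounds [f] from below and the descent lemma at [v] bounds it from
    above. *)
Lemma convex_above_tangent_sqr L f u v : 0 < L -> smooth L f ->
  convex_function setT f ->
  f u + dotp (gradient f u) (v - u)
    + enorm (gradient f v - gradient f u) ^+ 2 / (2 * L) <= f v.
Proof.
move=> L0 sf cf; set p := gradient f v - gradient f u.
have := smooth_upper v (v - L^-1 *: p) sf.
have := convex_above_tangent u (v - L^-1 *: p) (ltW L0) sf cf.
rewrite addrBl -addrA !enormN enormZ gtr0_norm ?invr_gt0//.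
rewrite exprMn !dotpDr !dotpNr !dotpZr.
have -> : enorm p ^+ 2 / (2 * L) = L^-1 * dotp p p / 2.
  by rewrite sqr_enorm; field; rewrite gt_eqF.
have -> : L / 2 * (L^-1 ^+ 2 * enorm p ^+ 2) = L^-1 * dotp p p / 2.
  by rewrite sqr_enorm; field; rewrite gt_eqF.
have -> : dotp p p = dotp (gradient f v) p - dotp (gradient f u) p.
  by rewrite {1}/p dotpDl dotpNl.
lra.
Qed.

(* Baillon-Haddad *)
Lemma gradient_cocoercive L f u v : 0 < L -> smooth L f ->
  convex_function setT f ->
  enorm (gradient f v - gradient f u) ^+ 2
    <= L * dotp (gradient f v - gradient f u) (v - u).
Proof.
move=> L0 sf cf.
have := convex_above_tangent_sqr u v L0 sf cf.
have := convex_above_tangent_sqr v u L0 sf cf.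
rewrite (enormC (gradient f u)) -(opprB v u) dotpNr => A B.
rewrite dotpDl dotpNl; move: A B.
move: (dotp _ (v - u)) (dotp _ (v - u)) (enorm _ ^+ 2) => a b c A B.
have : c / (2 * L) * 2 <= a - b by lra.
have -> : c / (2 * L) * 2 = c / L by field; rewrite gt_eqF.
by rewrite ler_pdivrMr// mulrC.
Qed.

(** A gradient step of size [1 / L] lowers [f] by at least [|grad f u|^2 / (2 L)] and cannot go
    below [b]. *)
Lemma smooth_gradient_bound L f u b : 0 < L -> smooth L f ->
  (forall v, b <= f v) -> enorm (gradient f u) ^+ 2 <= 2 * L * (f u - b).
Proof.
move=> L0 sf fb; have := smooth_upper u (u - L^-1 *: gradient f u) sf.
rewrite addrBl enormN enormZ gtr0_norm ?invr_gt0// exprMn.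
rewrite dotpNr dotpZr -sqr_enorm.
have := fb (u - L^-1 *: gradient f u).
move: (enorm _ ^+ 2) => c A B.
have : b <= f u - c / (2 * L).
  rewrite (le_trans A)// (le_trans B)// le_eqVlt; apply/orP; left; apply/eqP.
  by field; rewrite gt_eqF.
have -> : c / (2 * L) = (2 * L)^-1 * c by rewrite mulrC.
have LL : 0 < 2 * L by rewrite mulr_gt0.
by rewrite lerBrDr addrC -lerBrDr ler_pdivrMl.
Qed.

Definition grad_step a f u := u - a *: gradient f u.

Lemma grad_step_dist L a f u v : 0 < L -> 0 <= a -> smooth L f ->
  convex_function setT f ->
  enorm (grad_step a f v - grad_step a f u) ^+ 2 <= enorm (v - u) ^+ 2
    - a * (2 - a * L) * dotp (gradient f v - gradient f u) (v - u).
Proof.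
move=> L0 a0 sf cf; have := gradient_cocoercive u v L0 sf cf.
have -> : grad_step a f v - grad_step a f u
    = (v - u) - a *: (gradient f v - gradient f u).
  by rewrite /grad_step scalerBr !opprD !opprK addrACA.
move: (gradient f v - gradient f u) (v - u) => p h.
rewrite !sqr_enorm !dotpE (dotpC h p) => H.
have : a ^+ 2 * dotp p p <= a ^+ 2 * (L * dotp p h).
  by rewrite ler_wpM2l// sqr_ge0.
lra.
Qed.

Lemma grad_step_nonexp L a f u v : 0 < L -> 0 <= a -> a * L <= 2 ->
  smooth L f -> convex_function setT f ->
  enorm (grad_step a f v - grad_step a f u) <= enorm (v - u).
Proof.
move=> L0 a0 aL sf cf; rewrite -ler_sqr ?nnegrE ?enorm_ge0//.
rewrite (le_trans (grad_step_dist u v L0 a0 sf cf))// lerBlDr lerDl.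
apply: mulr_ge0; first by rewrite mulr_ge0// subr_ge0.
rewrite -(pmulr_rge0 _ L0).
by rewrite (le_trans _ (gradient_cocoercive u v L0 sf cf))// sqr_ge0.
Qed.

(** If no distance is lost, the strict inequality [a * L < 2] makes the inner product in
    [grad_step_dist] nonpositive, and cocoercivity then annihilates the difference of gradients. *)
Lemma grad_step_dist_eq L a f u v : 0 < L -> 0 < a -> a * L < 2 ->
  smooth L f -> convex_function setT f ->
  enorm (v - u) <= enorm (grad_step a f v - grad_step a f u) ->
  gradient f v = gradient f u.
Proof.
move=> L0 a0 aL sf cf; rewrite -ler_sqr ?nnegrE ?enorm_ge0// => H.
have := gradient_cocoercive u v L0 sf cf.
have {H} := le_trans H (grad_step_dist u v L0 (ltW a0) sf cf).
rewrite -subr_ge0 addrBl oppr_ge0 pmulr_rle0; last first.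
  by rewrite mulr_gt0// subr_gt0.
move=> A B; have {A B} : enorm (gradient f v - gradient f u) ^+ 2 <= 0.
  by rewrite (le_trans B)// pmulr_rle0.
by rewrite sqr_enorm => A; apply/eqP; rewrite -subr_eq0; apply/eqP/dotp_eq0/eqP;
  rewrite eq_le A dotp_ge0.
Qed.

Lemma grad_step_contraction L mu a f u v : 0 < L -> 0 <= a -> a * L <= 2 ->
  smooth L f -> convex_function setT f -> strongly_convex mu f ->
  enorm (grad_step a f v - grad_step a f u) ^+ 2
    <= (1 - a * (mu * (2 - a * L))) * enorm (v - u) ^+ 2.
Proof.
move=> L0 a0 aL sf cf [_ /(_ u v) H].
rewrite (le_trans (grad_step_dist u v L0 a0 sf cf))//.
have : a * (2 - a * L) * (mu * enorm (v - u) ^+ 2) <=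
   a * (2 - a * L) * dotp (gradient f v - gradient f u) (v - u).
  by rewrite ler_wpM2l// mulr_ge0// subr_ge0.
lra.
Qed.

(** Cauchy-Schwarz at two distinct points, available since the dimension is [d.+1]. It will make the
    radicand of the rate nonnegative. *)
Lemma strongly_convex_le_smooth L mu f :
  smooth L f -> strongly_convex mu f -> mu <= L.
Proof.
move=> [_ /(_ 0 (const_mx 1)) sf] [_ /(_ 0 (const_mx 1)) H].
have h0 : 0 < enorm (const_mx 1 - 0 : 'rV[R]_d.+1).
  rewrite lt_def enorm_ge0 andbT; apply/eqP => /enorm_eq0/rowP/(_ ord0).
  by rewrite !mxE subr0 => /eqP; rewrite oner_eq0.
rewrite -(ler_pM2r (exprn_gt0 2 h0)) (le_trans H)//.
rewrite (le_trans (dotp_le_enorm _ _))// expr2 mulrA ler_wpM2r//.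
exact: ltW.
Qed.
End SmoothConvex.

(** * Compactness and limits of matrices *)

Lemma cvg_sumr {R : numFieldType} {V : normedModType R} {T : Type}
    {F : set_system T} {FF : Filter F} (I : Type) (r : seq I) (P : pred I)
    (u : I -> T -> V) (l : I -> V) :
  (forall i, P i -> u i x @[x --> F] --> l i) ->
  \sum_(i <- r | P i) u i x @[x --> F] --> \sum_(i <- r | P i) l i.
Proof.
move=> ul; elim: r => [|i r IH].
  by rewrite big_nil; under eq_fun do rewrite big_nil; exact: cvg_cst.
rewrite big_cons; under eq_fun do rewrite big_cons.
by case: ifPn => // Pi; apply: cvgD => //; exact: ul.
Qed.

Lemma mx_coord_norm {R : realType} {m n : nat} (M : 'M[R]_(m, n)) i j :
  `|M i j| <= `|M|.
Proof.
rewrite [leRHS]/Num.norm/= mx_normrE; apply/bigmax_geP; right.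
by exists (i, j).
Qed.

Section MatrixTopology.
Context {R : realType} {m n : nat}.

Lemma cvg_mx {T : Type} {F : set_system T} {FF : Filter F}
    (u : T -> 'M[R]_(m, n)) (M : 'M[R]_(m, n)) :
  (forall i j, u x i j @[x --> F] --> M i j) -> u x @[x --> F] --> M.
Proof.
move=> uM; apply/cvg_ballP => e e0.
have H (ij : 'I_m * 'I_n) :
    \forall x \near F, ball (M ij.1 ij.2) e (u x ij.1 ij.2).
  by move/cvg_ballP : (uM ij.1 ij.2); exact.
have {}H := filter_forall FF H.
by apply: filterS H => x Hx; split => // i j; exact: (Hx (i, j)).
Qed.

Lemma cvg_mx_coord {T : Type} {F : set_system T} {FF : Filter F}
    (u : T -> 'M[R]_(m, n)) (M : 'M[R]_(m, n)) i j :
  u x @[x --> F] --> M -> u x i j @[x --> F] --> M i j.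
Proof.
by move=> uM; apply: (cvg_comp u (fun N : 'M[R]_(m, n) => N i j) uM);
  exact: coord_continuous.
Qed.

(** Compactness gives a cluster point, and an ultrafilter converges to its cluster points because it
    contains every set or its complement. *)
Lemma ultra_cvg_compact {I : Type} {T : topologicalType} {U : set_system I}
    {UU : UltraFilter U} (u : I -> T) (K : set T) :
  compact K -> U (u @^-1` K) -> exists2 p, K p & u x @[x --> U] --> p.
Proof.
move=> cK UK; have [p [Kp clp]] := cK (u @ U) _ UK.
exists p => // A pA; have [//|UA] := in_ultra_setVsetC (u @^-1` A) UU.
by have [q [+ Aq]] := clp (~` A) A UA pA; move=> /(_ Aq).
Qed.

Lemma compact_box (c : R) : compact [set M : 'M[R]_(m, n) |
  forall i j, `|M i j| <= c].
Proof.
rewrite compact_ultra => F UF FA.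
have H (ij : 'I_m * 'I_n) : exists p : R, `|p| <= c /\
    (M : 'M[R]_(m, n)) ij.1 ij.2 @[M --> F] --> p.
  have [||p] := @ultra_cvg_compact _ _ F UF
    (fun M : 'M[R]_(m, n) => M ij.1 ij.2 : R) `[- c, c].
  - exact: segment_compact.
  - by apply: filterS FA => M /(_ ij.1 ij.2); rewrite ler_norml /= in_itv.
  by rewrite /= in_itv /= -ler_norml => ? ?; exists p.
have [p Hp] := choice H.
exists (\matrix_(i, j) p (i, j)); split => /=.
  by move=> i j; rewrite mxE; have [] := Hp (i, j).
by apply: (@cvg_mx _ F _ id) => i j; rewrite mxE; have [] := Hp (i, j).
Qed.

Lemma coercive_min (G : 'M[R]_(m, n) -> R) (c : R) : continuous G ->
  (forall M, G M <= G 0 -> forall i j, `|M i j| <= c) ->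
  exists M0, forall M, G M0 <= G M.
Proof.
move=> cG Gc; pose box := [set M : 'M[R]_(m, n) | forall i j, `|M i j| <= c].
have box0 : box 0 by exact: Gc.
have [||M0 _ M0min] := @compact_EVT_min _ R G box _ (@compact_box c).
- by exists 0.
- exact: continuous_subspaceT.
exists M0 => M; have [/Gc MM|/ltW GM] := leP (G M) (G 0).
  by apply: M0min; rewrite inE.
by rewrite (le_trans _ GM)// M0min// inE.
Qed.

End MatrixTopology.

(** On a sphere around a minimizer [u0] that avoids all minimizers, [phi] exceeds its minimum by a
    positive gap. Convexity along rays from [u0] then makes [phi] grow at least linearly beyond the
    sphere. *)
Lemma convex_sublevel_bounded {R : realType} {d : nat}
    (phi : 'rV[R]_d.+1 -> R) (c : R) : continuous phi ->
  (forall u v (t : R), 0 <= t <= 1 ->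
    phi (t *: u + (1 - t) *: v) <= t * phi u + (1 - t) * phi v) ->
  minimizers phi !=set0 -> bounded_set (minimizers phi) ->
  exists r : R, forall u, phi u <= c -> `|u| <= r.
Proof.
move=> cphi conv [u0 u0min] /pinfty_ex_gt0[r0 r00 Hr0].
(* A point at distance [rho] from [u0] has norm at least [r0 + 1], hence is not a minimizer. *)
pose rho := r0 + `|u0| + 1.
have rho0 : 0 < rho by rewrite ltr_wpDl// addr_ge0// ltW.
pose S := [set u : 'rV[R]_d.+1 | `|u - u0| = rho].
have cN : continuous (fun u : 'rV[R]_d.+1 => `|u - u0|).
  by move=> u; exact: (cvg_norm (cvgB cvg_id (cvg_cst _))).
have cS : compact S.
  apply: bounded_closed_compact.
    exists (rho + `|u0|); split; first exact: num_real.
    move=> M /ltW MM u /= us; rewrite (le_trans _ MM)// -us.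
    by rewrite -{1}(subrK u0 u) ler_normD.
  by apply: (closed_comp _ (@closed_eq _ rho)) => u _; exact: cN.
have S0 : S !=set0.
  exists (u0 + const_mx rho); rewrite /S/= addrBl.
  rewrite -[const_mx rho](_ : rho *: const_mx 1 = _); last first.
    by apply/rowP => l; rewrite !mxE mulr1.
  rewrite normrZ gtr0_norm// -[RHS]mulr1; congr (_ * _).
  rewrite /Num.norm/= mx_normrE; apply/le_anti/andP; split.
    by apply/bigmax_leP; split => // -[i j] _; rewrite mxE normr1.
  by apply/bigmax_geP; right; exists (ord0, ord0); rewrite //= mxE normr1.
have [p pS pmin] := @compact_EVT_min _ R phi S S0 cS
  (continuous_subspaceT cphi).
have {}pS : `|p - u0| = rho by rewrite inE in pS.
have u0p : phi u0 < phi p.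
  rewrite lt_neqAle u0min andbT; apply/eqP => E.
  have /Hr0 : minimizers phi p by move=> v; rewrite -E; exact: u0min.
  apply/negP; rewrite -ltNge; have := lerB_dist p u0.
  have := ler_normB p u0; rewrite pS /rho.
  lra.
exists (`|u0| + rho + `|rho * (c - phi u0) / (phi p - phi u0)|) => u uc.
suff H : `|u - u0| <= rho + `|rho * (c - phi u0) / (phi p - phi u0)|.
  by rewrite -{1}(subrK u0 u) (le_trans (ler_normD _ _))// addrC -addrA lerD2l.
have [ur|ur] := leP `|u - u0| rho; first by rewrite (le_trans ur)// lerDl.
have uu0 : 0 < `|u - u0| by rewrite (lt_trans rho0).
rewrite (ler_wpDl (ltW rho0))// (le_trans _ (ler_norm _))//.
rewrite ler_pdivlMr ?subr_gt0// -ler_pdivlMl//.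
(* For this [t], the point [u0 + t *: (u - u0)] lies on the sphere, where [phi] is at least
   [phi p]. *)
pose t := rho / `|u - u0|.
have t0 : 0 <= t by rewrite divr_ge0// ltW.
have t1 : t <= 1 by rewrite ler_pdivrMr// mul1r ltW.
have q : t *: u + (1 - t) *: u0 = u0 + t *: (u - u0).
  by rewrite scalerBl scale1r scalerBr addrCA.
have := conv u u0 t; rewrite t0 t1 q => /(_ isT).
have : phi p <= phi (u0 + t *: (u - u0)).
  apply: pmin; rewrite inE /S /= addrBl normrZ ger0_norm// /t.
  by rewrite divfK// gt_eqF.
have : t * phi u <= t * c by rewrite ler_wpM2l.
have -> : `|u - u0|^-1 * (rho * (c - phi u0)) = t * (c - phi u0).
  by rewrite /t; ring.
lra.
Qed.

(** * Existence of a fixed point *)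

Section FrobeniusProduct.
Context {R : realType} {n d : nat}.
Implicit Types (x y z : 'M[R]_(n, d)) (A W : 'M[R]_n) (a : R).

Definition fdot x y : R := \sum_i dotp (row i x) (row i y).

Lemma fdotC x y : fdot x y = fdot y x.
Proof. by apply: eq_bigr => i _; rewrite dotpC. Qed.

Lemma fdotDl x y z : fdot (x + y) z = fdot x z + fdot y z.
Proof.
by rewrite -big_split; apply: eq_bigr => i _; rewrite linearD dotpDl.
Qed.

Lemma fdotZl a x y : fdot (a *: x) y = a * fdot x y.
Proof. by rewrite mulr_sumr; apply: eq_bigr => i _; rewrite linearZ dotpZl. Qed.

Lemma fdotDr x y z : fdot z (x + y) = fdot z x + fdot z y.
Proof. by rewrite fdotC fdotDl !(fdotC z). Qed.

Lemma fdotZr a x y : fdot x (a *: y) = a * fdot x y.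
Proof. by rewrite fdotC fdotZl fdotC. Qed.

Lemma fdotNl x y : fdot (- x) y = - fdot x y.
Proof. by rewrite -scaleN1r fdotZl mulN1r. Qed.

Lemma fdotNr x y : fdot x (- y) = - fdot x y.
Proof. by rewrite fdotC fdotNl fdotC. Qed.

Definition fdotE := (fdotDl, fdotDr, fdotZl, fdotZr, fdotNl, fdotNr).

Lemma fdot_ge0 x : 0 <= fdot x x.
Proof. by apply: sumr_ge0 => i _; exact: dotp_ge0. Qed.

Lemma fdot_le0 x : fdot x x <= 0 -> x = 0.
Proof.
move=> x0; have /eqP : fdot x x = 0 by apply/eqP; rewrite eq_le x0 fdot_ge0.
rewrite psumr_eq0 => [/allP H|i _]; last exact: dotp_ge0.
apply/row_matrixP => i; rewrite row0; apply: dotp_eq0.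
by apply/eqP/H/mem_index_enum.
Qed.

Lemma fdot_trace x y : fdot x y = \tr (x *m y^T).
Proof.
apply: eq_bigr => i _; rewrite !mxE; apply: eq_bigr => l _.
by rewrite !mxE.
Qed.

Lemma fdot_mulmx A x y : fdot (A *m x) y = fdot x (A^T *m y).
Proof. by rewrite !fdot_trace trmx_mul trmxK mulmxA -mulmxA mxtrace_mulC. Qed.

Lemma row_mulmx_sum A x i : row i (A *m x) = \sum_j A i j *: row j x.
Proof.
by rewrite row_mul mulmx_sum_row; apply: eq_bigr => j _; rewrite mxE.
Qed.

Lemma positive_definite_fdot W x : positive_definite W -> 0 <= fdot (W *m x) x.
Proof.
move=> [_ Wpos]; rewrite fdot_trace mxtrace_mulC.
apply: sumr_ge0 => l _.
have -> : (x^T *m (W *m x)) l l = (row l x^T *m W *m (row l x^T)^T) 0 0.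
  rewrite tr_row trmxK -row_mul mulmxA !mxE.
  by apply: eq_bigr => k _; rewrite [row _ _ _ _]mxE [col _ _ _ _]mxE.
have [->|x0] := eqVneq (row l x^T) 0; last exact/ltW/Wpos.
by rewrite !mul0mx mxE.
Qed.

Lemma positive_definite_unitmx W : positive_definite W -> W \in unitmx.
Proof.
move=> [_ Wpos]; rewrite -row_free_unit -kermx_eq0; apply/rowV0P => v.
move=> /sub_kermxP vW; apply/eqP; apply: contraT => /Wpos.
by rewrite vW mul0mx mxE ltxx.
Qed.

(* With [y = W^-1 x], the gap between the two sides is
   [<W (y - x), y - x> >= 0]. *)
Lemma fdot_laplacian_le W x : positive_definite W ->
  fdot (x - W *m x) x <= fdot (invmx W *m x - x) x.
Proof.
move=> Wpos; have Wu := positive_definite_unitmx Wpos.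
have [WT _] := Wpos.
set y := invmx W *m x.
have Wy : W *m y = x by rewrite mulKVmx.
have := positive_definite_fdot (y - x) Wpos.
rewrite mulmxBr Wy.
have WW : fdot (W *m x) y = fdot x x by rewrite fdot_mulmx WT Wy.
rewrite !fdotE WW (fdotC x y); lra.
Qed.

(** The Dirichlet form of the Laplacian [1 - W]: in the expanded squares, the unit row and column
    sums collapse the two diagonal terms to [fdot x x]. *)
Lemma fdot_laplacian W x : W^T = W -> doubly_stochastic W ->
  fdot (x - W *m x) x =
  (\sum_i \sum_j W i j * enorm (row i x - row j x) ^+ 2) / 2.
Proof.
move=> WT [_ Wr Wc]; rewrite fdotDl fdotNl.
have -> : \sum_i \sum_j W i j * enorm (row i x - row j x) ^+ 2 =
  \sum_i \sum_j W i j * dotp (row i x) (row i x) +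
  \sum_i \sum_j W i j * dotp (row j x) (row j x) -
  2 * \sum_i \sum_j W i j * dotp (row j x) (row i x).
  rewrite mulr_sumr -sumrN -!big_split /=; apply: eq_bigr => i _.
  rewrite mulr_sumr -sumrN -!big_split /=; apply: eq_bigr => j _.
  rewrite sqr_enorm !dotpE (dotpC (row i x) (row j x)); ring.
have -> : \sum_i \sum_j W i j * dotp (row i x) (row i x) = fdot x x.
  by apply: eq_bigr => i _; rewrite -mulr_suml Wr mul1r.
have -> : \sum_i \sum_j W i j * dotp (row j x) (row j x) = fdot x x.
  rewrite exchange_big; apply: eq_bigr => j _.
  by rewrite -mulr_suml Wc mul1r.
have -> : \sum_i \sum_j W i j * dotp (row j x) (row i x) = fdot (W *m x) x.
  apply: eq_bigr => i _; rewrite row_mulmx_sum dotp_suml.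
  by apply: eq_bigr => j _; rewrite dotpZl.
by field.
Qed.

Lemma continuous_fdot A : continuous (fun x => fdot (A *m x) x).
Proof.
move=> x; have ? := nbhs_filter x.
apply: cvg_sumr => i _; apply: cvg_sumr => l _; apply: cvgM.
  rewrite !mxE; under eq_fun do rewrite !mxE.
  apply: cvg_sumr => k _; apply: cvgM; first exact: cvg_cst.
  exact: coord_continuous.
rewrite mxE; under eq_fun do rewrite mxE.
exact: coord_continuous.
Qed.

Lemma continuous_row (i : 'I_n) : continuous (fun x => row i x).
Proof.
move=> x; have ? := nbhs_filter x; apply: cvg_mx => k l.
rewrite mxE; under eq_fun do rewrite mxE.
exact: coord_continuous.
Qed.

End FrobeniusProduct.

Lemma connect_ind_rel (T : finType) (e : rel T) (P : T -> T -> Prop) :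
  (forall x, P x x) -> (forall x y z, e x y -> P y z -> P x z) ->
  forall x y, connect e x y -> P x y.
Proof.
move=> P0 PS x y /connectP[p + ->].
by elim: p x => //= z p IH x /andP[/PS + /IH]; exact.
Qed.

(** * The penalized objective, its sublevel sets and its minimizer *)

Section FixedPoint.
Context {R : realType} {n d : nat}.
Variables (e : rel 'I_n.+1) (W : 'M[R]_n.+1).
Variables (f : 'I_n.+1 -> 'rV[R]_d.+1 -> R) (L : 'I_n.+1 -> R) (alpha : R).
Hypothesis he : connected_graph e.
Hypothesis hW : pd_averaging_matrix e W.
Hypothesis f_convex : forall i, convex_function setT (f i).
Hypothesis L_gt0 : forall i, 0 < L i.
Hypothesis f_smooth : forall i, smooth (L i) (f i).
Hypothesis f_lbound : forall i, has_lbound (range (f i)).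
Hypothesis opt_neq0 : minimizers (fun u => \sum_i f i u) !=set0.
Hypothesis opt_bounded : bounded_set (minimizers (fun u => \sum_i f i u)).
Hypothesis alpha_gt0 : 0 < alpha.

(* Since [W] is invertible, the critical points of this convex function are
   exactly the fixed points of synchronous DGD-ATC. *)
Let G (x : 'M[R]_(n.+1, d.+1)) :=
  alpha * \sum_i f i (row i x) + fdot ((invmx W - 1%:M) *m x) x / 2.

Let continuous_f i : continuous (f i).
Proof.
by move=> u; apply: differentiable_continuous; have [] := f_smooth i.
Qed.

Let continuous_G : continuous G.
Proof.
move=> x; have ? := nbhs_filter x; apply: cvgD.
  apply: cvgM; first exact: cvg_cst.
  apply: cvg_sumr => i _; apply: (@continuous_comp _ _ _ (row i) (f i)).
    exact: continuous_row.
  exact: continuous_f.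
apply: cvgM; [exact: continuous_fdot|exact: cvg_cst].
Qed.

(** Since the [f i] are bounded below, the Laplacian form is bounded on a sublevel set, hence so is
    the disagreement across each edge; these bounds are added along a path. *)
Let sublevel_consensus (c : R) i j : exists C : R, forall x, G x <= c ->
  enorm (row i x - row j x) <= C.
Proof.
have [_ _ hconn] := he; have [Wpd [W0 Wr Wc] Wpos _] := hW.
have [b fb] := choice f_lbound.
(* One factor 2 undoes the halving in [G], the other the halving in [fdot_laplacian]. *)
pose C := (c - alpha * \sum_i b i) * 4.
have GC x : G x <= c ->
    \sum_i \sum_j W i j * enorm (row i x - row j x) ^+ 2 <= C.
  move=> Gx; have := fdot_laplacian_le x Wpd.
  rewrite fdot_laplacian//; last by case: Wpd.
  have : alpha * \sum_i b i <= alpha * \sum_i f i (row i x).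
    rewrite ler_wpM2l ?(ltW alpha_gt0)// ler_sum// => k _.
    by apply: fb; exists (row k x).
  by move: Gx; rewrite /G mulmxBl mul1mx /C; lra.
have WC x k l : G x <= c -> W k l * enorm (row k x - row l x) ^+ 2 <= C.
  move=> /GC; apply: le_trans.
  have H k' l' : 0 <= W k' l' * enorm (row k' x - row l' x) ^+ 2.
    by rewrite mulr_ge0// sqr_ge0.
  rewrite (bigD1 k)//= (bigD1 l)//= -addrA lerDl addr_ge0// sumr_ge0// => k' _.
  exact: sumr_ge0.
move: i j (hconn i j); apply: connect_ind_rel => [i|i j k eij [C' HC']].
  by exists 0 => x _; rewrite subrr enorm0.
have Wij : 0 < W i j by rewrite Wpos// eij.
exists (Num.sqrt (`|C| / W i j) + C') => x Gx.
rewrite (le_trans (enorm_tri _ (row j x) _))// lerD//; last exact: HC'.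
rewrite le_enorm ?sqrtr_ge0// sqr_sqrtr ?divr_ge0 ?normr_ge0 ?(ltW Wij)//.
rewrite ler_pdivlMr// mulrC -sqr_enorm (le_trans (WC _ _ _ Gx))//.
exact: ler_norm.
Qed.

Let fdot_A_ge0 x : 0 <= fdot ((invmx W - 1%:M) *m x : 'M[R]_(n.+1, d.+1)) x.
Proof.
have [Wpd Wds _ _] := hW.
rewrite mulmxBl mul1mx (le_trans _ (fdot_laplacian_le x Wpd))//.
rewrite fdot_laplacian//; last by case: Wpd.
rewrite divr_ge0// sumr_ge0// => i _; rewrite sumr_ge0// => j _.
by rewrite mulr_ge0 ?sqr_ge0//; case: Wds.
Qed.

Let sublevel_f (c : R) i : exists C : R, forall x, G x <= c ->
  f i (row i x) <= C.
Proof.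
have [b fb] := choice f_lbound.
exists ((c - alpha * \sum_(j | j != i) b j) / alpha) => x Gx.
rewrite ler_pdivlMr// mulrC.
have : alpha * \sum_(j | j != i) b j
    <= alpha * \sum_(j | j != i) f j (row j x).
  rewrite ler_wpM2l ?(ltW alpha_gt0)// ler_sum// => k _.
  by apply: fb; exists (row k x).
have := fdot_A_ge0 x; move: Gx; rewrite /G (bigD1 i)//=; lra.
Qed.

(** The bound on [f i] at row [i] is moved to row [ord0] by the descent lemma centred at row [i]:
    consensus bounds the displacement and [smooth_gradient_bound] the gradient. *)
Let sublevel_f0 (c : R) i : exists C : R, forall x, G x <= c ->
  f i (row ord0 x) <= C.
Proof.
have [C1 H1] := sublevel_f c i.
have [C2 H2] := sublevel_consensus c ord0 i.
have [b fb] := f_lbound i.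
pose g := Num.sqrt `|2 * L i * (C1 - b)|.
exists (C1 + g * `|C2| + L i / 2 * C2 ^+ 2) => x Gx.
rewrite (le_trans (smooth_upper (row i x) _ (f_smooth i)))//.
have {}H2 := H2 _ Gx.
have C20 : 0 <= C2 by rewrite (le_trans _ H2)// enorm_ge0.
rewrite lerD//; last first.
  rewrite ler_wpM2l ?divr_ge0 ?(ltW (L_gt0 i))//.
  by rewrite ler_sqr ?nnegrE// enorm_ge0.
rewrite lerD ?H1// (le_trans (dotp_le_enorm _ _))//.
rewrite ler_pM ?enorm_ge0//; last by rewrite (le_trans H2)// ler_norm.
rewrite -ler_sqr ?nnegrE ?enorm_ge0 ?sqrtr_ge0// [g ^+ 2]sqr_sqrtr//.
rewrite (le_trans _ (ler_norm _))//.
rewrite (le_trans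
  (smooth_gradient_bound (b := b) _ (L_gt0 i) (f_smooth i) _))//.
  by move=> v; apply: fb; exists v.
by rewrite ler_wpM2l ?mulr_ge0 ?(ltW (L_gt0 i))// lerD2r H1.
Qed.

(** All [f i] are bounded above at the common point [row ord0 x], so boundedness of the solution set
    confines this row through [convex_sublevel_bounded]; consensus confines the others. *)
Let sublevel_bounded (c : R) : exists C : R, forall x, G x <= c ->
  forall i j, `|x i j| <= C.
Proof.
have [C1 H1] := choice (sublevel_f0 c).
have [C2 H2] := choice (fun i => sublevel_consensus c i ord0).
have cphi : continuous (fun u => \sum_i f i u).
  move=> u; have ? := nbhs_filter u.
  by apply: cvg_sumr => i _; exact: continuous_f.
have conv u v (t : R) : 0 <= t <= 1 -> \sum_i f i (t *: u + (1 - t) *: v)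
    <= t * \sum_i f i u + (1 - t) * \sum_i f i v.
  move=> t01; rewrite !mulr_sumr -big_split ler_sum// => i _.
  exact: convex_functionE.
have [r Hr] := convex_sublevel_bounded (\sum_i C1 i) cphi conv opt_neq0
  opt_bounded.
exists (\sum_i `|C2 i| + r) => x Gx i j.
rewrite -(subrK (x ord0 j) (x i j)) (le_trans (ler_normD _ _))// lerD//.
  have -> : x i j - x ord0 j = (row i x - row ord0 x) 0 j by rewrite !mxE.
  rewrite (le_trans (enorm_coord _ _))// (le_trans (H2 _ _ Gx))//.
  by rewrite (le_trans (ler_norm _))// (bigD1 i)//= lerDl sumr_ge0.
have -> : x ord0 j = row ord0 x 0 j by rewrite mxE.
rewrite (le_trans _ (Hr (row ord0 x) _))//; last first.
  by apply: ler_sum => k _; exact: H1.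
exact: mx_coord_norm.
Qed.

(** The gradient [p] of [G] at a minimizer [x] vanishes, as seen by testing the points [x - t *: p];
    and [W *m p] is the residual of the fixed point equation. *)
Lemma sync_fixed_point_exists : exists x, sync_fixed_point W f alpha x.
Proof.
have [C HC] := sublevel_bounded (G 0).
have [x xmin] := coercive_min continuous_G HC.
exists x; have [Wpd Wds _ _] := hW; have Wu := positive_definite_unitmx Wpd.
have [WT _] := Wpd.
pose A := invmx W - 1%:M; have AT : A^T = A.
  by rewrite linearB/= trmx_inv WT trmx1.
have [p pE] : exists p, p = alpha *: stacked_gradient f x + A *m x by eexists.
(* Second-order coefficient: [G (x - t *: p) <= G x - t * fdot p p + t ^+ 2 * q]. *)
pose q := alpha * (\sum_i L i / 2 * enorm (row i p) ^+ 2) + fdot (A *m p) p / 2.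
have p0 : p = 0.
  apply: fdot_le0; apply: (@le0_of_le_scaled _ _ q) => t /andP[t0 _].
  rewrite -(ler_pM2l t0).
  have := xmin (x - t *: p); rewrite /G.
  have fi : \sum_i f i (row i (x - t *: p)) <= \sum_i (f i (row i x)
      - t * dotp (gradient (f i) (row i x)) (row i p)
      + t ^+ 2 * (L i / 2 * enorm (row i p) ^+ 2)).
    apply: ler_sum => i _; rewrite linearB linearZ /=.
    rewrite (le_trans (smooth_upper (row i x) _ (f_smooth i)))//.
    rewrite addrBl dotpNr dotpZr enormN enormZ exprMn real_normK ?num_real//.
    by rewrite mulrCA.
  move: fi; rewrite !big_split /= sumrN -!mulr_sumr.
  have -> : \sum_i dotp (gradient (f i) (row i x)) (row i p) =
      fdot (stacked_gradient f x) p.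
    by apply: eq_bigr => i _; rewrite rowK.
  have -> : fdot (A *m (x - t *: p)) (x - t *: p) =
      fdot (A *m x) x - 2 * t * fdot (A *m x) p + t ^+ 2 * fdot (A *m p) p.
    rewrite mulmxBr -scalemxAr !fdotE.
    have -> : fdot (A *m p) x = fdot (A *m x) p.
      by rewrite fdot_mulmx AT fdotC.
    ring.
  have -> : fdot p p = alpha * fdot (stacked_gradient f x) p + fdot (A *m x) p.
    by rewrite {1}pE fdotDl fdotZl.
  rewrite /q => H1 H2.
  have := ler_wpM2l (ltW alpha_gt0) H1; move: H2; rewrite -/A; lra.
rewrite /sync_fixed_point; apply/eqP; rewrite -subr_eq0; apply/eqP.
transitivity (W *m p); last by rewrite p0 mulmx0.
rewrite pE /A mulmxBl mul1mx !mulmxDr !mulmxN mulKVmx//.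
by rewrite opprD opprK addrA addrC.
Qed.

End FixedPoint.

(** * Partially asynchronous iterations *)

(** Otherwise [U] would contain the complements of all fibres; these are finitely many and have
    empty intersection. *)
Lemma ultra_finite_const {I : Type} {T : finType} {U : set_system I}
    {UU : UltraFilter U} (u : I -> T) : exists q, \forall k \near U, u k = q.
Proof.
apply: contrapT => H; have {}H q : U (~` [set k | u k = q]).
  by have [Uq|//] := in_ultra_setVsetC [set k | u k = q] UU; case: H; exists q.
have PU : ProperFilter U by exact: ultra_proper.
have /filter_ex[k /(_ (u k))] : \forall k \near U, forall q, u k <> q.
  by apply: filter_forall => q; exact: H.
exact.
Qed.

Lemma filter_ex2 {I : Type} {F : set_system I} {FF : ProperFilter F}
    (P Q : set I) : F P -> F Q -> exists k, P k /\ Q k.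
Proof. by move=> FP FQ; exact: filter_ex (filterI FP FQ). Qed.

Section RowConvergence.
Context {R : realType} {n d : nat} {I : Type} {F : set_system I}.
Context {FF : Filter F}.
Implicit Types (X : I -> 'M[R]_(n, d)) (y : 'M[R]_(n, d)).

Lemma cvg_row_enorm X y (eps : R) : 0 < eps -> X k @[k --> F] --> y ->
  \forall k \near F, forall i, enorm (row i (X k) - row i y) <= eps.
Proof.
move=> eps0 Xy; apply: filter_forall => i.
have : enorm (row i (X k) - row i y) @[k --> F] --> Num.sqrt (0 : R).
  apply: (continuous_cvg _ (@sqrt_continuous R 0)).
  rewrite -(dotp0l (0 : 'rV[R]_d)) /dotp; apply: cvg_sumr => l _.
  have H : (row i (X k) - row i y) 0 l @[k --> F] --> (0 : 'rV[R]_d) 0 l.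
    rewrite mxE -(subrr (y i l)); under eq_fun do rewrite !mxE.
    by apply: cvgB; [exact: cvg_mx_coord|exact: cvg_cst].
  exact: cvgM.
rewrite sqrtr0 => /cvgr0_norm_le/(_ _ eps0); apply: filterS => k.
by apply: le_trans; exact: ler_norm.
Qed.

Lemma row_enorm_cvg X y :
  (forall eps : R, 0 < eps -> \forall k \near F,
    forall i, enorm (row i (X k) - row i y) <= eps) -> X k @[k --> F] --> y.
Proof.
move=> H; apply: cvg_mx => i j; apply/cvgrPdist_le => eps /H.
apply: filterS => k /(_ i); apply: le_trans.
by rewrite (le_trans _ (enorm_coord _ j))// !mxE distrC.
Qed.

End RowConvergence.

(** * Delayed averaging with abstract nonexpansive maps [g j] *)

Section AsynchronousIteration.
Context {R : realType} {n d : nat}.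
Variables (e : rel 'I_n.+1) (W : 'M[R]_n.+1).
Variable (g : 'I_n.+1 -> 'rV[R]_d -> 'rV[R]_d).
Variables (B D : nat).
Implicit Types (x y z : 'M[R]_(n.+1, d)) (X Z : nat -> 'M[R]_(n.+1, d)).
Implicit Types (i j : 'I_n.+1) (t k m : nat) (v rho : R).

Definition closed_nbh i j := e i j || (j == i).

Definition avg_fixed y := forall i,
  row i y = \sum_(j | closed_nbh i j) W i j *: g j (row j y).

(** Delays are ordinals bounded by [D], so the type is finite and an ultrafilter can freeze the
    pattern of a node at a given shift. *)
Definition pattern := option {ffun 'I_n.+1 -> 'I_D.+1}.

(* [Some delta]: node [i] updates using the value of node [j] that is
   [delta j] iterations old; [None]: node [i] is idle. *)
Definition async_step X i m (o : pattern) : Prop :=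
  if o is Some delta then
    delta i = ord0 /\ row i (X m.+1) =
      \sum_(j | closed_nbh i j) W i j *: g j (row j (X (m - delta j)%N))
  else row i (X m.+1) = row i (X m).

(** The starting time [a] serves the limit trajectories, for which the rule is established from time
    [D] on, where no delayed index is truncated at 0. *)
Definition async_trajectory a X (o : nat -> 'I_n.+1 -> pattern) : Prop :=
  (forall i m, (a <= m)%N -> async_step X i m (o m i)) /\
  (forall i k, (a <= k)%N -> exists2 t, (k <= t <= k + B)%N & o t i).

Hypothesis W_gt0 : forall i j, closed_nbh i j -> 0 < W i j.
Hypothesis W_sum1 : forall i, \sum_(j | closed_nbh i j) W i j = 1.

Lemma closed_nbh_refl i : closed_nbh i i.
Proof. by rewrite /closed_nbh eqxx orbT. Qed.

Definition dev X y t i := enorm (row i (X t) - row i y).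

Lemma wavg_le (p q : 'I_n.+1 -> 'rV[R]_d) i v :
  (forall j, closed_nbh i j -> enorm (p j - q j) <= v) ->
  enorm (\sum_(j | closed_nbh i j) W i j *: p j
       - \sum_(j | closed_nbh i j) W i j *: q j) <= v.
Proof.
move=> H; rewrite -sumrB (le_trans (enorm_sum _ _ _))//.
rewrite -[leRHS]mul1r -(W_sum1 i) mulr_suml ler_sum// => j Nij.
rewrite -scalerBr enormZ gtr0_norm ?W_gt0//.
by rewrite ler_wpM2l ?H// ltW// W_gt0.
Qed.

Section Lipschitz.
Variable rho : R.
Hypothesis rho_ge0 : 0 <= rho.
Hypothesis g_lip : forall j u w, enorm (g j u - g j w) <= rho * enorm (u - w).

Lemma async_update_le X i m (delta : {ffun 'I_n.+1 -> 'I_D.+1}) y v :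
  avg_fixed y -> async_step X i m (Some delta) ->
  (forall t j, (m - D <= t <= m)%N -> dev X y t j <= v) ->
  dev X y m.+1 i <= rho * v.
Proof.
move=> fy [_ E] H; rewrite /dev E fy; apply: wavg_le => j Nij.
rewrite (le_trans (g_lip _ _ _))// ler_wpM2l// H// leq_subr andbT.
by rewrite leq_sub2l// -ltnS ltn_ord.
Qed.

End Lipschitz.

Hypothesis g_nonexp : forall j u w, enorm (g j u - g j w) <= enorm (u - w).

Let g_lip1 j u w : enorm (g j u - g j w) <= 1 * enorm (u - w).
Proof. by rewrite mul1r. Qed.

Lemma dev_ge0 X y t i : 0 <= dev X y t i. Proof. exact: enorm_ge0. Qed.

(** The condition on [a] and [b] says that reads made from time [b] on never go back before [a], so
    strong induction on time propagates the bound. For [a = b = 0] it is trivial. *)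
Lemma dev_stable X o y a b v : async_trajectory 0 X o -> avg_fixed y ->
  (forall t, (b <= t)%N -> (a <= t - D)%N) ->
  (forall t i, (a <= t <= b)%N -> dev X y t i <= v) ->
  forall t i, (a <= t)%N -> dev X y t i <= v.
Proof.
move=> [Xo _] fy ab Hb; elim/ltn_ind => t IH i at_.
have [tb|bt] := leqP t b; first by rewrite Hb// at_.
case: t bt IH at_ => // m bm IH _.
have := Xo i m isT; case: (o m i) => [delta st|/= E].
  rewrite -[v]mul1r; apply: (async_update_le ler01 g_lip1 fy st) => t j.
  move=> /andP[mt tm]; apply: IH; first by rewrite ltnS.
  by rewrite (leq_trans _ mt)// ab.
by rewrite /dev E; apply: IH; rewrite // (leq_trans (ab _ bm))// leq_subr.
Qed.

(** From time [M + D] on, all reads are at times at least [M], so each update gains the factor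
    [rho]. Every node updates within [B] further steps and shows the result one step later;
    afterwards both idling and updating keep the bound. *)
Lemma dev_block X o y rho : 0 <= rho <= 1 ->
  (forall j u w, enorm (g j u - g j w) <= rho * enorm (u - w)) ->
  async_trajectory 0 X o -> avg_fixed y ->
  forall M v, (forall t i, (M <= t)%N -> dev X y t i <= v) ->
  forall t i, (M + (B + D + 1) <= t)%N -> dev X y t i <= rho * v.
Proof.
move=> /andP[rho0 rho1] g_rho [Xo XB] fy M v HM t i.
have upd m : (M + D <= m)%N -> o m i -> dev X y m.+1 i <= rho * v.
  move=> Mm; have := Xo i m isT; case: (o m i) => // delta st _.
  apply: (async_update_le rho0 g_rho fy st) => t' j /andP[mt' _].
  by apply: HM; lia.
have [t0 /andP[Mt0 t0M] ot0] := XB i (M + D)%N isT.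
suff H k : dev X y (t0.+1 + k) i <= rho * v.
  by move=> Mt; have -> : t = (t0.+1 + (t - t0.+1))%N by lia.
elim: k => [|k IH]; first by rewrite addn0 upd.
rewrite addnS; have := Xo i (t0.+1 + k)%N isT.
case E : (o _ i) => [delta|/=]; last by rewrite /dev => ->.
by move=> _; apply: upd; [lia|rewrite E].
Qed.

Lemma dev_geometric X o y rho v : 0 <= rho <= 1 ->
  (forall j u w, enorm (g j u - g j w) <= rho * enorm (u - w)) ->
  async_trajectory 0 X o -> avg_fixed y ->
  (forall i, dev X y 0 i <= v) ->
  forall t i, dev X y t i <= rho ^+ (t %/ (B + D + 1)) * v.
Proof.
move=> rho01 g_rho Xo fy H0.
suff H m t i : (m * (B + D + 1) <= t)%N -> dev X y t i <= rho ^+ m * v.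
  by move=> t i; apply: H; exact: leq_trunc_div.
elim: m t i => [|m IH] t i.
  move=> _; rewrite mul1r.
  apply: (dev_stable (a := 0) (b := 0) Xo fy) => // t' j.
  by rewrite leqn0 => /eqP ->; exact: H0.
by rewrite mulSn addnC exprS -mulrA => /(dev_block rho01 g_rho Xo fy IH).
Qed.

Hypothesis g_rigid : forall j u w,
  enorm (u - w) <= enorm (g j u - g j w) -> g j u - g j w = u - w.

(** * Trajectories attaining the maximal deviation from a fixed point *)

Section ExtremalTrajectory.
Variables (X : nat -> 'M[R]_(n.+1, d)) (o : nat -> 'I_n.+1 -> pattern).
Variables (y : 'M[R]_(n.+1, d)) (v : R).
Hypothesis Xo : async_trajectory D X o.
Hypothesis fy : avg_fixed y.
Hypothesis Xv : forall t i, dev X y t i <= v.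

Let extremal t i := v <= dev X y t i.

(** An average of vectors of norm at most [v] has norm [v], so [wavg_extremal] makes them all equal;
    [g_rigid] then turns equality after [g j] into equality before it. *)
Let extremal_update t i delta : (D <= t)%N -> o t i = Some delta ->
  extremal t.+1 i -> forall j, closed_nbh i j ->
  row j (X (t - delta j)%N) - row j y = row i (X t.+1) - row i y /\
  g j (row j (X (t - delta j)%N)) - g j (row j y)
    = row i (X t.+1) - row i y.
Proof.
move=> Dt ot vi; have := Xo.1 i t Dt; rewrite ot => -[_ E].
have {}E : \sum_(j | closed_nbh i j) W i j *:
    (g j (row j (X (t - delta j)%N)) - g j (row j y))
    = row i (X t.+1) - row i y.
  by rewrite E fy -sumrB; apply: eq_bigr => j _; rewrite scalerBr.
have gv j : closed_nbh i j ->
    enorm (g j (row j (X (t - delta j)%N)) - g j (row j y)) <= v.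
  by move=> _; rewrite (le_trans (g_nonexp _ _ _))//; exact: Xv.
have ev : enorm (\sum_(j | closed_nbh i j) W i j *:
    (g j (row j (X (t - delta j)%N)) - g j (row j y))) = v.
  by apply/le_anti; rewrite E -/(dev X y _ _) Xv.
move=> j Nij.
have := wavg_extremal (W_gt0 (i := i)) (W_sum1 i) gv ev Nij.
rewrite E => gE; split => //; rewrite -gE; apply/esym/g_rigid.
by rewrite gE (le_trans _ vi)//; exact: Xv.
Qed.

(** A node reads itself with delay 0, so an update that ends at an extremal value started from the
    same row. *)
Let extremal_back t i s : extremal t i -> (D <= s <= t)%N ->
  row i (X s) = row i (X t).
Proof.
move=> vi /andP[Ds]; elim: t vi => [|t IH] vi st.
  by move: st; rewrite leqn0 => /eqP ->.
have [->//|/eqP sNt] := eqVneq s t.+1.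
have {}st : (s <= t)%N by lia.
have XX : row i (X t) = row i (X t.+1).
  have Dt := leq_trans Ds st.
  have := Xo.1 i t Dt; case ot : (o t i) => [delta|/=]; last by move=> ->.
  move=> [d0 _]; have [+ _] := extremal_update Dt ot vi (closed_nbh_refl i).
  by rewrite d0 subn0 => /addIr.
by rewrite -XX; apply: IH; rewrite // /extremal /dev XX.
Qed.

(** Node [i] updates at one of the [B.+1] times before [t]. The value of [j] read there dates from
    [s] or later and is extremal with the same deviation vector; [extremal_back] carries it to
    [s]. *)
Let extremal_nbh t i j s : extremal t i -> closed_nbh i j -> (D <= s)%N ->
  (s + (B + D + 1) <= t)%N ->
  extremal s j /\ row j (X s) - row j y = row i (X t) - row i y.
Proof.
move=> vi Nij Ds st.
have [t' /andP[t't tt'] ot'] := Xo.2 i (t - B.+1)%N ltac:(lia).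
have Et' : row i (X t'.+1) = row i (X t) by apply: extremal_back => //; lia.
have vt' : extremal t'.+1 i by rewrite /extremal /dev Et'.
case E : (o t' i) ot' => [delta|//] _.
have [H _] := extremal_update (t := t') ltac:(lia) E vt' Nij.
have dD := ltn_ord (delta j).
have vj : extremal (t' - delta j) j by rewrite /extremal /dev H.
have Es : row j (X s) = row j (X (t' - delta j)%N).
  by apply: extremal_back => //; lia.
by rewrite /extremal /dev Es H Et'.
Qed.

(** A path without repetition among [n.+1] nodes has at most [n] edges, and each edge costs
    [B + D + 1] steps back in time. *)
Let extremal_connect t i j s : extremal t i -> connect e i j -> (D <= s)%N ->
  (s + n * (B + D + 1) <= t)%N ->
  extremal s j /\ row j (X s) - row j y = row i (X t) - row i y.
Proof.
move=> vi /connectP[p0 p0e ->]; case: (shortenP p0e) => p pe up _ Ds st.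
have {st up} : (s + size p * (B + D + 1) <= t)%N.
  have := max_card [in i :: p]; rewrite (card_uniqP up) card_ord /= ltnS => pn.
  by rewrite (leq_trans _ st)// leq_add2l leq_mul2r pn orbT.
elim: p i t vi pe {p0 p0e} => [|k p IH] i t vi /=.
  move=> _; rewrite mul0n addn0 => st.
  have E : row i (X s) = row i (X t) by apply: extremal_back => //; rewrite Ds.
  by rewrite /extremal /dev E.
move=> /andP[eik pe] st.
have Nik : closed_nbh i k by rewrite /closed_nbh eik.
have Ds' : (D <= s + size p * (B + D + 1))%N.
  by rewrite (leq_trans Ds) ?leq_addr.
have [|vk Ek] := extremal_nbh vi Nik Ds'; first by rewrite -addnA -mulSnr.
by rewrite -Ek; apply: (IH k) => //.
Qed.

Hypothesis e_connected : forall i j, connect e i j.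

(** The threshold places [t] at least [n * (B + D + 1)] steps after the window from [D] to
    [2 * D + B + 1], on which all nodes then share one deviation vector [u]. *)
Lemma extremal_trajectory_fixed t i : extremal t i ->
  (n * (B + D + 1) + 2 * D + B + 1 <= t)%N ->
  avg_fixed (X D) /\ forall s, (D <= s <= D + D)%N -> X s = X D.
Proof.
move=> vi tbig; have [u uE] : exists u, u = row i (X t) - row i y by eexists.
have H s j : (D <= s)%N -> (s <= D + D + B + 1)%N ->
    extremal s j /\ row j (X s) - row j y = u.
  move=> Ds sD; rewrite uE; apply: extremal_connect => //; lia.
have XsD s : (D <= s <= D + D)%N -> X s = X D.
  move=> /andP[Ds sD]; apply/row_matrixP => j.
  have [_] := H s j Ds ltac:(lia); have [_ <-] := H D j (leqnn _) ltac:(lia).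
  by move/addIr.
split=> // k.
(* Node [j] updates at some time from [D] to [D + B] and reads itself without delay, which shows
   that [g j] also translates by [u]. *)
have gu j : g j (row j (X D)) = g j (row j y) + u.
  have [t' /andP[Dt' t'D] ot'] := Xo.2 j D (leqnn _).
  case E : (o t' j) ot' => [delta|//] _.
  have [vj Ej] := H t'.+1 j ltac:(lia) ltac:(lia).
  have [_] := extremal_update (t := t') ltac:(lia) E vj (closed_nbh_refl j).
  have := Xo.1 j t' Dt'; rewrite E => -[-> _]; rewrite subn0 Ej => <-.
  rewrite subrKC; congr (g j _).
  by apply: extremal_back; [have [] := H t' j ltac:(lia) ltac:(lia)|lia].
transitivity (row k y + u).
  by have [_ <-] := H D k (leqnn _) ltac:(lia); rewrite subrKC.
rewrite fy -[u in LHS]scale1r -(W_sum1 k) scaler_suml -big_split /=.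
by apply: eq_bigr => j _; rewrite gu scalerDr.
Qed.

End ExtremalTrajectory.

(** The shifts stay in a compact box, hence converge along [U]; the patterns take finitely many
    values, hence are constant along [U]. The recursion passes to the limit because the [g j] are
    nonexpansive. *)
Lemma async_limit_trajectory X o (U : set_system nat) (c : R) :
  UltraFilter U -> \oo `<=` U -> async_trajectory 0 X o ->
  (forall t i (l : 'I_d), `|X t i l| <= c) ->
  exists Z p, async_trajectory D Z p /\
    forall t, X (k + t)%N @[k --> U] --> Z t.
Proof.
move=> UU ooU [Xo XB] Xc; have PU : ProperFilter U by exact: ultra_proper.
have [Z XZ] : {Z : nat -> 'M[R]_(n.+1, d) &
    forall t, X (k + t)%N @[k --> U] --> Z t}.
  apply: (choice (P := fun t z => X (k + t)%N @[k --> U] --> z)) => t.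
  have UK : U ((fun k => X (k + t)%N)
      @^-1` [set M | forall i l, `|M i l| <= c]).
    by apply: filterE => k /= i j; exact: Xc.
  by have [z _ Xz] := ultra_cvg_compact (@compact_box R n.+1 d c) UK; exists z.
have [p op] : {p : nat * 'I_n.+1 -> pattern &
    forall ti, \forall k \near U, o (k + ti.1)%N ti.2 = p ti}.
  apply: (choice (P := fun ti q => \forall k \near U, o (k + ti.1)%N ti.2 = q)).
  by move=> ti; exact: ultra_finite_const.
exists Z, (fun t i => p (t, i)); split => //; split => [i m Dm|i k Dk].
  have Xopm := op (m, i).
  case E : (p (m, i)) Xopm => [delta|] /= Xopm; last first.
    apply/eqP; rewrite -subr_eq0; apply/eqP/enorm_eq0/le_anti.
    rewrite enorm_ge0 andbT; apply/ler_addgt0Pr => eps eps0; rewrite add0r.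
    have eps2 : 0 < eps / 2 by rewrite divr_gt0.
    have [k [ok [H1 H2]]] := filter_ex2 Xopm
      (filterI (cvg_row_enorm (F := U) eps2 (XZ m))
        (cvg_row_enorm (F := U) eps2 (XZ m.+1))).
    have := Xo i (k + m)%N isT; rewrite ok /= -addnS => Ek.
    rewrite (le_trans (enorm_tri _ (row i (X (k + m.+1)%N)) _))//.
    rewrite [leRHS]splitr lerD//; first by rewrite enormC.
    by rewrite Ek.
  have [k0 d0] : exists k, o (k + m)%N i = Some delta by exact: filter_ex Xopm.
  split; first by have := Xo i (k0 + m)%N isT; rewrite d0 => -[].
  apply/eqP; rewrite -subr_eq0; apply/eqP/enorm_eq0/le_anti.
  rewrite enorm_ge0 andbT; apply/ler_addgt0Pr => eps eps0; rewrite add0r.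
  have eps2 : 0 < eps / 2 by rewrite divr_gt0.
  have Hd : \forall k \near U, forall j : 'I_n.+1, forall i',
      enorm (row i' (X (k + (m - delta j))%N) - row i' (Z (m - delta j)%N))
        <= eps / 2.
    by apply: filter_forall => j; exact: cvg_row_enorm.
  have [k [ok [H1 H2]]] := filter_ex2 Xopm
    (filterI Hd (cvg_row_enorm (F := U) eps2 (XZ m.+1))).
  have := Xo i (k + m)%N isT; rewrite ok /= -addnS => -[_ Ek].
  rewrite (le_trans (enorm_tri _ (row i (X (k + m.+1)%N)) _))//.
  rewrite [leRHS]splitr lerD//; first by rewrite enormC.
  rewrite Ek; apply: wavg_le => j _; rewrite (le_trans (g_nonexp _ _ _))//.
  (* Here [delta j <= D <= m], so the subtraction commutes with the shift by [k]. *)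
  by rewrite -addnBA ?H1//; have := ltn_ord (delta j); lia.
(* Only [B.+1] times are involved, so one shift [k'] realizes the limit pattern at all of them and
   transfers the update found there. *)
have Hp : \forall k' \near U, forall r : 'I_B.+1,
    o (k' + (k + r))%N i = p ((k + r)%N, i).
  by apply: filter_forall => r; exact: (op ((k + r)%N, i)).
have [k' Hk'] := filter_ex Hp.
have [t /andP[kt tk] ot] := XB i (k' + k)%N isT.
exists (t - k')%N; first by lia.
have rB : (t - k' - k < B.+1)%N by lia.
have := Hk' (Ordinal rB) => /=.
have -> : (k + (t - k' - k))%N = (t - k')%N by lia.
have -> : (k' + (t - k'))%N = t by lia.
by move=> /= <-.
Qed.

Hypothesis e_connected : forall i j, connect e i j.

Theorem async_trajectory_cvg X o y : async_trajectory 0 X o -> avg_fixed y ->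
  exists xs, avg_fixed xs /\ X k @[k --> \oo] --> xs.
Proof.
move=> Xo fy.
pose M0 := \sum_i dev X y 0 i.
have devM0 t i : dev X y t i <= M0.
  apply: (dev_stable (a := 0) (b := 0) Xo fy) => // t' j.
  rewrite leqn0 => /eqP ->.
  by rewrite /M0 (bigD1 j)//= lerDl sumr_ge0// => k _; exact: dev_ge0.
have Xbnd t i (l : 'I_d) : `|X t i l| <= M0 + `|y|.
  rewrite -(subrK (y i l) (X t i l)) (le_trans (ler_normD _ _))// lerD//.
    rewrite (le_trans _ (devM0 t i))// /dev (le_trans _ (enorm_coord _ l))//.
    by rewrite !mxE.
  exact: mx_coord_norm.
(* The infimum of these eventual bounds is the limit superior of the block-max deviation. *)
pose S := [set w : R | 0 <= w /\
  exists k, forall t i, (k <= t)%N -> dev X y t i <= w].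
have S0 : S !=set0.
  by exists M0; split; [apply: sumr_ge0 => i _; exact: dev_ge0|exists 0].
have lS : has_lbound S by exists 0 => w [].
pose v := inf S.
have va eps : 0 < eps -> exists k, forall t i, (k <= t)%N ->
    dev X y t i <= v + eps.
  move=> eps0; have [w [_ [k Hk]] wv] := inf_adherent eps0 (conj S0 lS).
  by exists k => t i kt; rewrite (le_trans (Hk t i kt))// ltW.
(* Every window of [D.+1] times contains a deviation of at least [v]: otherwise its maximum [w < v]
   would bound all later deviations by [dev_stable]. *)
have vb k : exists q : 'I_D.+1 * 'I_n.+1, v <= dev X y (k + q.1)%N q.2.
  apply: contrapT => H.
  have {}H (q : 'I_D.+1 * 'I_n.+1) : dev X y (k + q.1)%N q.2 < v.
    by rewrite ltNge; apply/negP => vq; apply: H; exists q.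
  have v0 : 0 < v := le_lt_trans (dev_ge0 _ _ _ _) (H (ord0, ord0)).
  pose w := \big[Num.max/0]_(q : 'I_D.+1 * 'I_n.+1) dev X y (k + q.1)%N q.2.
  have wv : w < v by apply/bigmax_ltP; split.
  suff : S w by move=> /(ge_inf lS); rewrite leNgt wv.
  split; first exact: bigmax_ge_id.
  exists k => t i kt.
  apply: (dev_stable (a := k) (b := (k + D)%N) Xo fy) => //.
    by move=> t' ?; lia.
  move=> t' j /andP[kt' tk'].
  have tD : (t' - k < D.+1)%N by lia.
  apply/bigmax_geP; right; exists (Ordinal tD, j) => //=.
  by rewrite subnKC.
have [U [UU ooU]] := ultraFilterLemma (F := \oo) _.
have PU : ProperFilter U by exact: ultra_proper.
have [Z [p [Zp XZ]]] := async_limit_trajectory UU ooU Xo Xbnd.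
have Zv t i : dev Z y t i <= v.
  apply/ler_addgt0Pr => eps eps0.
  have eps2 : 0 < eps / 2 by rewrite divr_gt0.
  have [k0 Hk0] := va _ eps2.
  have [k [k0k H]] := filter_ex2 (ooU _ (nbhs_infty_ge k0))
    (cvg_row_enorm (F := U) eps2 (XZ t)).
  rewrite /dev (le_trans (enorm_tri _ (row i (X (k + t)%N)) _))//.
  have := Hk0 (k + t)%N i (leq_trans k0k (leq_addr _ _)).
  by have := H i; rewrite enormC /dev; lra.
pose N := (n * (B + D + 1) + 2 * D + B + 1)%N.
have [qk Hqk] := choice vb.
(* The time offset and the node of a large deviation vary with the window; among finitely many
   pairs, [U] selects one. *)
have [q Hq] := ultra_finite_const (U := U) (fun k => qk (k + N)%N).
have Zq : v <= dev Z y (N + q.1)%N q.2.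
  apply/ler_addgt0Pr => eps eps0.
  have [k [qE /(_ q.2) H]] := filter_ex2 Hq
    (cvg_row_enorm (F := U) eps0 (XZ (N + q.1)%N)).
  have := Hqk (k + N)%N; rewrite qE -addnA => vk.
  rewrite (le_trans vk)// /dev.
  rewrite (le_trans (enorm_tri _ (row q.2 (Z (N + q.1)%N)) _))//.
  by rewrite [leRHS]addrC lerD2r.
have [fZ ZD] :=
  extremal_trajectory_fixed Zp fy Zv e_connected Zq (leq_addr _ _).
exists (Z D); split => //; apply: row_enorm_cvg => eps eps0.
(* [Z] equals [Z D] on a whole delay window, so for some [k] the iterates are within [eps] of it
   there; [dev_stable] around the fixed point [Z D] keeps them so. *)
have : \forall k \near U, forall (r : 'I_D.+1) i,
    enorm (row i (X (k + (D + r))%N) - row i (Z D)) <= eps.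
  apply: filter_forall => r.
  rewrite -(ZD (D + r)%N); first exact: cvg_row_enorm.
  by have := ltn_ord r; lia.
move=> /filter_ex[k Hk].
exists (k + D)%N => // t /= kt i.
apply: (dev_stable (a := (k + D)%N) (b := (k + D + D)%N) Xo fZ) => //.
  by move=> t' ?; lia.
move=> t' j /andP[kt' tk'].
have tD : (t' - (k + D) < D.+1)%N by lia.
have := Hk (Ordinal tD) j => /=.
by have -> : (k + (D + (t' - (k + D))))%N = t' by lia.
Qed.

End AsynchronousIteration.

(** * Asynchronous DGD-ATC *)

Section Bridge.
Context {R : realType} {n d : nat}.
Variables (e : rel 'I_n.+1) (W : 'M[R]_n.+1) (f : 'I_n.+1 -> 'rV[R]_d.+1 -> R).
Hypothesis hW : pd_averaging_matrix e W.

Lemma closed_nbh_gt0 i j : closed_nbh e i j -> 0 < W i j.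
Proof.
by have [_ _ H _] := hW => Nij; apply: H; rewrite eq_sym.
Qed.

Lemma closed_nbh_sum (V : lmodType R) (F : 'I_n.+1 -> V) i :
  \sum_(j | closed_nbh e i j) W i j *: F j = \sum_j W i j *: F j.
Proof.
have [_ _ _ H] := hW; rewrite [LHS]big_mkcond; apply: eq_bigr => j _.
by case: ifPn => // Nij; rewrite H ?scale0r// eq_sym.
Qed.

Lemma closed_nbh_sum1 i : \sum_(j | closed_nbh e i j) W i j = 1.
Proof.
have [_ [_ Wr _] _ _] := hW; have := closed_nbh_sum (fun=> 1 : R^o) i.
rewrite (eq_bigr (W i)) => [->|j _]; last by rewrite [LHS]mulr1.
by rewrite -[RHS](Wr i); apply: eq_bigr => j _; rewrite [LHS]mulr1.
Qed.

Lemma sync_fixed_pointE alpha x : sync_fixed_point W f alpha x <->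
  avg_fixed e W (fun j => grad_step alpha (f j)) x.
Proof.
have E i : row i (W *m (x - alpha *: stacked_gradient f x)) =
    \sum_(j | closed_nbh e i j) W i j *: grad_step alpha (f j) (row j x).
  rewrite row_mulmx_sum closed_nbh_sum; apply: eq_bigr => j _.
  by rewrite linearB linearZ /= rowK.
split=> [fx i|fx]; first by rewrite {1}fx E.
by apply/row_matrixP => i; rewrite E; exact: fx.
Qed.

Lemma enorm_row_bnorm (x : 'M[R]_(n.+1, d.+1)) i : enorm (row i x) <= bnorm x.
Proof. exact: (le_bigmax _ (fun i => enorm (row i x)) i). Qed.

Lemma bnorm_le (x : 'M[R]_(n.+1, d.+1)) v :
  (forall i, enorm (row i x) <= v) -> bnorm x <= v.
Proof.
move=> H; apply/bigmax_leP; split => //.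
by rewrite (le_trans _ (H ord0))// enorm_ge0.
Qed.

Lemma async_dgd_trajectory alpha K s B D x :
  partially_asynchronous e K s B D -> async_dgd_atc e W f alpha K s x ->
  exists o,
    async_trajectory e W (fun j => grad_step alpha (f j)) B (D := D) 0 x o.
Proof.
move=> [HB HD] [Hs _ Hx].
(* [inord] is faithful on delays at most [D], which covers the neighbours and [i] itself; the
   entries of other nodes never enter the sum. *)
exists (fun m i => if m \in K i then Some [ffun j => inord (m - s i j m)]
  else None); split => [i m _|i k _]; last first.
  by have [t kt tK] := HB i k; exists t; rewrite ?tK.
rewrite /async_step Hx; case: ifPn => // mK; split.
  by apply/val_inj; rewrite ffunE Hs// subnn /= inordK.
apply: eq_bigr => j /orP Nij; rewrite ffunE.
suff -> : (m - (inord (m - s i j m) : 'I_D.+1))%N = s i j m by [].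
have /andP[? ?] : (m - D <= s i j m <= m)%N.
  by case: Nij => [eij|/eqP ->]; [exact: HD|rewrite Hs// leqnn leq_subr].
by rewrite inordK; lia.
Qed.

End Bridge.

Lemma step_size_lt2 {R : realType} {n : nat} (L : 'I_n.+1 -> R) (alpha : R) i :
  (forall j, 0 < L j) -> alpha < 2 / \big[Num.max/0]_j L j -> 0 < alpha ->
  alpha * L i < 2.
Proof.
move=> L0 al a0; have Li : L i <= \big[Num.max/0]_j L j by exact: le_bigmax.
have M0 := lt_le_trans (L0 i) Li.
move: al; rewrite ltr_pdivlMr//; apply: le_lt_trans.
by rewrite ler_wpM2l// ltW.
Qed.

Theorem theorem6 (R : realType) (n d : nat)
  (e : rel 'I_n.+1) (he : connected_graph e)
  (W : 'M[R]_n.+1) (hW : pd_averaging_matrix e W)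
  (f : 'I_n.+1 -> 'rV[R]_d.+1 -> R) (L : 'I_n.+1 -> R)
  (f_convex : forall i, convex_function setT (f i))
  (L_gt0 : forall i, 0 < L i)
  (f_smooth : forall i, smooth (L i) (f i))
  (f_lbound : forall i, has_lbound (range (f i)))
  (opt_neq0 : minimizers (fun u => \sum_i f i u) !=set0)
  (opt_bounded : bounded_set (minimizers (fun u => \sum_i f i u)))
  (K : 'I_n.+1 -> set nat) (s : 'I_n.+1 -> 'I_n.+1 -> nat -> nat) (B D : nat)
  (hBD : partially_asynchronous e K s B D)
  (alpha : R) (alpha_gt0 : 0 < alpha)
  (alpha_lt : alpha < 2 / \big[Num.max/0]_i L i)
  (x : nat -> 'M[R]_(n.+1, d.+1)) (hx : async_dgd_atc e W f alpha K s x) :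
  exists xs : 'M[R]_(n.+1, d.+1),
    [/\ sync_fixed_point W f alpha xs,
        x k @[k --> \oo] --> xs
      & forall mu : 'I_n.+1 -> R,
          (forall i, 0 < mu i /\ strongly_convex (mu i) (f i)) ->
          let c i := mu i * (2 - alpha * L i) in
          let r := 1 - alpha * \big[Num.min/c ord0]_i c i in
          let rho := Num.sqrt r in
          [/\ 0 <= r, 0 <= rho < 1
            & forall k, bnorm (x k - xs)
                <= rho ^+ (k %/ (B + D + 1))%N * bnorm (x 0%N - xs)]].
Proof.
have aL i : alpha * L i < 2 := step_size_lt2 i L_gt0 alpha_lt alpha_gt0.
pose g j := grad_step alpha (f j).
have g_nonexp j u w : enorm (g j u - g j w) <= enorm (u - w).
  by apply: (@grad_step_nonexp _ _ (L j)); rewrite // ltW.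
have g_rigid j u w : enorm (u - w) <= enorm (g j u - g j w) ->
    g j u - g j w = u - w.
  move=> H; rewrite /g /grad_step.
  rewrite (@grad_step_dist_eq _ _ (L j) alpha (f j) w u)//.
  by rewrite opprB addrA subrK.
have W0 := closed_nbh_gt0 hW; have W1 := closed_nbh_sum1 hW.
have [_ _ e_conn] := he.
have [p xo] := async_dgd_trajectory hBD hx.
have [y fy] := sync_fixed_point_exists he hW f_convex L_gt0 f_smooth f_lbound
  opt_neq0 opt_bounded alpha_gt0.
have [xs [fxs xxs]] := async_trajectory_cvg W0 W1 g_nonexp g_rigid e_conn xo
  ((sync_fixed_pointE f hW alpha y).1 fy).
exists xs; split => //; first exact/(sync_fixed_pointE f hW).
move=> mu mu_sc c r rho.
have mu0 i : 0 < mu i by have [] := mu_sc i.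
have cpos i : 0 < c i by rewrite mulr_gt0// subr_gt0.
have cmin j : \big[Num.min/c ord0]_i c i <= c j by exact: bigmin_le.
(* The default [c ord0] is one of the values, so this is a true minimum. *)
have min_gt0 : 0 < \big[Num.min/c ord0]_i c i by apply/bigmin_gtP; split.
(* With [a = alpha * mu ord0], the bound [mu ord0 <= L ord0] gives
   [alpha * c ord0 <= 2 * a - a ^+ 2 <= 1]. *)
have r_ge0 : 0 <= r.
  have mL : mu ord0 <= L ord0.
    exact: strongly_convex_le_smooth (f_smooth _) (mu_sc _).2.
  have : alpha * \big[Num.min/c ord0]_i c i <= alpha * c ord0.
    by rewrite ler_wpM2l// ltW.
  have : alpha * mu ord0 * (alpha * mu ord0)
      <= alpha * mu ord0 * (alpha * L ord0).
    rewrite ler_wpM2l ?mulr_ge0 ?(ltW (mu0 _)) ?(ltW alpha_gt0)//.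
    by rewrite ler_wpM2l// ltW.
  have := sqr_ge0 (alpha * mu ord0 - 1).
  rewrite /r /c; lra.
have rho01 : 0 <= rho < 1.
  rewrite sqrtr_ge0 /= -sqrtr1 ltr_sqrt// /r gtrBl.
  by rewrite mulr_gt0.
split => // k.
(* The minimum in [r] is at most [c j], so [rho ^+ 2] dominates the squared contraction factor of
   every node. *)
have g_rho j u w : enorm (g j u - g j w) <= rho * enorm (u - w).
  rewrite -ler_sqr ?nnegrE ?mulr_ge0 ?enorm_ge0 ?sqrtr_ge0//.
  rewrite exprMn [rho ^+ 2]sqr_sqrtr//.
  rewrite (le_trans (grad_step_contraction _ _ (L_gt0 j) (ltW alpha_gt0)
    (ltW (aL j)) (f_smooth j) (f_convex j) (mu_sc j).2))//.
  rewrite ler_wpM2r ?sqr_ge0// lerD2l lerN2.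
  by rewrite ler_wpM2l ?cmin ?(ltW alpha_gt0).
apply: bnorm_le => i; rewrite linearB /=.
have [rho0 /ltW rho1] := andP rho01.
apply: (dev_geometric W0 W1 g_nonexp _ g_rho xo fxs); first by rewrite rho0.
by move=> j; rewrite /dev -linearB; exact: enorm_row_bnorm.
Qed.
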